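(* Let $\mathbb{F}$ be an algebraically closed field of characteristic not $2,3$, and let $A_1(\alpha_1,\alpha_2,\alpha_4,\beta_1),\dots,A_{12}$ be the $2$-dimensional algebras over $\mathbb{F}$ given by the matrices of structure constants listed in the context. Then, for all values of the parameters $\alpha_1,\alpha_2,\alpha_4,\beta_1,\beta_2\in\mathbb{F}$ (subject to the restrictions indicated), the derivation algebras are: \begin{itemize} \item $Der(A_1(\alpha_1,\alpha_2,\alpha_4,\beta_1))=Der(A_2(\alpha_1,\beta_1,\beta_2))=Der(A_3(\beta_1,\beta_2))=\{0\}$; \item $Der(A_4(\alpha_1,\beta_2))=\left\{\begin{pmatrix}0&0\\0&d\end{pmatrix}: d\in\mathbb{F}\right\}$ if $\beta_2\neq 2\alpha_1-1$; \item $Der(A_4(\alpha_1,2\alpha_1-1))=\left\{\begin{pmatrix}0&0\\c&d\end{pmatrix}: c,d\in\mathbb{F}\right\}$; \item $Der(A_5(\alpha_1))=\left\{\begin{pmatrix}0&0\\c&0\end{pmatrix}: c\in\mathbb{F}\right\}$; \item $Der(A_6(\alpha_1,\beta_1))=Der(A_7(\beta_1))=\{0\}$; \item $Der(A_8(\alpha_1))=\left\{\begin{pmatrix}0&0\\0&d\end{pmatrix}: d\in\mathbb{F}\right\}$ if $\alpha_1\neq\frac13$, and $Der(A_8(\tfrac13))=\left\{\begin{pmatrix}0&0\\c&d\end{pmatrix}: c,d\in\mathbb{F}\right\}$; \item $Der(A_9)=\left\{\begin{pmatrix}0&0\\c&0\end{pmatrix}: c\in\mathbb{F}\right\}$; \item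 $Der(A_{10})=\left\{\begin{pmatrix}a&0\\0&0\end{pmatrix}: a\in\mathbb{F}\right\}$; \item $Der(A_{11})=\{0\}$; \item $Der(A_{12})=\left\{\begin{pmatrix}a&0\\c&2a\end{pmatrix}: a,c\in\mathbb{F}\right\}$. \end{itemize}
   Context: An algebra over $\mathbb{F}$ is a vector space with a bilinear multiplication (no associativity, commutativity or unit is assumed). A $2$-dimensional algebra $\mathbb{A}$ with fixed basis $e=(e^1,e^2)$ is identified with its matrix of structure constants (MSC) $A=\begin{pmatrix}\alpha_1&\alpha_2&\alpha_3&\alpha_4\\ \beta_1&\beta_2&\beta_3&\beta_4\end{pmatrix}\in M(2\times 4;\mathbb{F})$, meaning $\mathbf{u}\cdot\mathbf{v}=eA(u\otimes v)$ for $\mathbf{u}=eu$, $\mathbf{v}=ev$ with coordinate column vectors $u,v$. Explicitly, $e^1e^1=\alpha_1e^1+\beta_1e^2$, $e^1e^2=\alpha_2e^1+\beta_2e^2$, $e^2e^1=\alpha_3e^1+\beta_3e^2$, $e^2e^2=\alpha_4e^1+\beta_4e^2$. A derivation is a linear map $\mathbf{d}$ with $\mathbf{d}(\mathbf{u}\cdot\mathbf{v})=\mathbf{d}(\mathbf{u})\cdot\mathbf{v}+\mathbf{u}\cdot\mathbf{d}(\mathbf{v})$; it is represented by the matrix $D\in M(2;\mathbb{F})$ with $\mathbf{d}(eu)=eDu$, so that $$Der(A)=\{D\in M(2;\mathbb{F}): A(D\otimes I+I\otimes D)-DA=0\},$$ where $I$ is the $2\times2$ identity matrix and, for matrices $X=(x_{ij})$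 and $Y$, $X\otimes Y$ is the block matrix with blocks $(x_{ij}Y)$. The algebras are (all parameters are arbitrary elements of $\mathbb{F}$): $A_1(\alpha_1,\alpha_2,\alpha_4,\beta_1)=\begin{pmatrix}\alpha_1&\alpha_2&\alpha_2+1&\alpha_4\\ \beta_1&-\alpha_1&-\alpha_1+1&-\alpha_2\end{pmatrix}$; $A_2(\alpha_1,\beta_1,\beta_2)=\begin{pmatrix}\alpha_1&0&0&1\\ \beta_1&\beta_2&1-\alpha_1&0\end{pmatrix}$; $A_3(\beta_1,\beta_2)=\begin{pmatrix}0&1&1&0\\ \beta_1&\beta_2&1&-1\end{pmatrix}$; $A_4(\alpha_1,\beta_2)=\begin{pmatrix}\alpha_1&0&0&0\\ 0&\beta_2&1-\alpha_1&0\end{pmatrix}$; $A_5(\alpha_1)=\begin{pmatrix}\alpha_1&0&0&0\\ 1&2\alpha_1-1&1-\alpha_1&0\end{pmatrix}$; $A_6(\alpha_1,\beta_1)=\begin{pmatrix}\alpha_1&0&0&1\\ \beta_1&1-\alpha_1&-\alpha_1&0\end{pmatrix}$; $A_7(\beta_1)=\begin{pmatrix}0&1&1&0\\ \beta_1&1&0&-1\end{pmatrix}$; $A_8(\alpha_1)=\begin{pmatrix}\alpha_1&0&0&0\\ 0&1-\alpha_1&-\alpha_1&0\end{pmatrix}$; $A_9=\begin{pmatrix}\frac13&0&0&0\\ 1&\frac23&-\frac13&0\end{pmatrix}$; $A_{10}=\begin{pmatrix}0&1&1&0\\ 0&0&0&-1\end{pmatrix}$; $A_{11}=\begin{pmatrix}0&1&1&0\\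 1&0&0&-1\end{pmatrix}$; $A_{12}=\begin{pmatrix}0&0&0&0\\ 1&0&0&0\end{pmatrix}$. *)

(* Defs.v *)
From mathcomp Require Import all_boot all_algebra.
From mathcomp Require Import classical_sets.
From mathcomp.real_closed Require Import mxtens.

Set Implicit Arguments.
Unset Strict Implicit.
Unset Printing Implicit Defensive.

Import GRing.Theory.
Local Open Scope ring_scope.
Local Open Scope classical_set_scope.

Definition mx22 (F : fieldType) (a b c d : F) : 'M[F]_2 :=
  \matrix_(i < 2, j < 2) (if i == 0 then [:: a; b] else [:: c; d])`_j.

(* The four columns are the coordinates of e1e1, e1e2, e2e1, e2e2, in this
   order. The width is written 2 * 2 so that the matrix can be multiplied by
   Kronecker products; [tensmx X Y] is the block matrix (x_ij Y). *)
Definition msc (F : fieldType) (a1 a2 a3 a4 b1 b2 b3 b4 : F)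
    : 'M[F]_(2, 2 * 2) :=
  \matrix_(i < 2, j < 2 * 2)
    (if i == 0 then [:: a1; a2; a3; a4] else [:: b1; b2; b3; b4])`_j.

Definition alg_mul (F : fieldType) (A : 'M[F]_(2, 2 * 2)) (u v : 'cV[F]_2)
    : 'cV[F]_2 :=
  A *m tensmx u v.

Definition Der (F : fieldType) (A : 'M[F]_(2, 2 * 2)) : set 'M[F]_2 :=
  [set D | A *m (tensmx D 1%:M + tensmx 1%:M D) - D *m A = 0].

Lemma DerP (F : fieldType) (A : 'M[F]_(2, 2 * 2)) (D : 'M[F]_2) :
  Der A D <->
  forall u v : 'cV[F]_2,
    D *m alg_mul A u v = alg_mul A (D *m u) v + alg_mul A u (D *m v).
Proof.
have tE (u v : 'cV[F]_2) :
    alg_mul A (D *m u) v + alg_mul A u (D *m v) - D *m alg_mul A u v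
    = (A *m (tensmx D 1%:M + tensmx 1%:M D) - D *m A) *m tensmx u v.
  rewrite /alg_mul mulmxBl -!mulmxA mulmxDl !tensmx_mul !mul1mx.
  by rewrite mulmxDr.
split=> [DA u v|H].
  by apply/esym/eqP; rewrite -subr_eq0 tE DA mul0mx.
rewrite /Der /=; set M := (X in X = 0).
have M0 (u v : 'cV[F]_2) : M *m tensmx u v = 0 by rewrite -tE H subrr.
apply/matrixP => i j; case: (mxtens_indexP j) => k l; rewrite [RHS]mxE.
have := congr1 (fun X : 'cV_2 => X i 0) (M0 (delta_mx k 0) (delta_mx l 0)).
rewrite mxE (bigD1 (mxtens_index (k, l))) //= big1 => [|j'].
  by rewrite !mxE !mxtens_indexK /= !eqxx !ord1 /= !mulr1 addr0.
case: (mxtens_indexP j') => k' l' ne.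
rewrite !mxE !mxtens_indexK /= !ord1 !eqxx !andbT.
have [ek|] := eqVneq k' k; have [el|] := eqVneq l' l; rewrite ?mulr0 ?mul0r ?mulr0 //.
by rewrite ek el eqxx in ne.
Qed.

Section Algebras.
Variable F : fieldType.

Definition A_1 (a1 a2 a4 b1 : F) :=
  msc a1 a2 (a2 + 1) a4
      b1 (- a1) (- a1 + 1) (- a2).
Definition A_2 (a1 b1 b2 : F) :=
  msc a1 0 0 1
      b1 b2 (1 - a1) 0.
Definition A_3 (b1 b2 : F) :=
  msc 0 1 1 0
      b1 b2 1 (- 1).
Definition A_4 (a1 b2 : F) :=
  msc a1 0 0 0
      0 b2 (1 - a1) 0.
Definition A_5 (a1 : F) :=
  msc a1 0 0 0
      1 (2%:R * a1 - 1) (1 - a1) 0.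
Definition A_6 (a1 b1 : F) :=
  msc a1 0 0 1
      b1 (1 - a1) (- a1) 0.
Definition A_7 (b1 : F) :=
  msc 0 1 1 0
      b1 1 0 (- 1).
Definition A_8 (a1 : F) :=
  msc a1 0 0 0
      0 (1 - a1) (- a1) 0.
Definition A_9 : 'M[F]_(2, 2 * 2) :=
  msc (1 / 3%:R) 0 0 0
      1 (2%:R / 3%:R) (- (1 / 3%:R)) 0.
Definition A_10 : 'M[F]_(2, 2 * 2) :=
  msc 0 1 1 0
      0 0 0 (- 1).
Definition A_11 : 'M[F]_(2, 2 * 2) :=
  msc 0 1 1 0
      1 0 0 (- 1).
Definition A_12 : 'M[F]_(2, 2 * 2) :=
  msc 0 0 0 0
      1 0 0 0.

End Algebras.

Arguments A_9 F : clear implicits.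
Arguments A_10 F : clear implicits.
Arguments A_11 F : clear implicits.
Arguments A_12 F : clear implicits.

(* Main.v *)
Require Import Defs.
From mathcomp Require Import all_boot all_algebra.
From mathcomp Require Import classical_sets.
From mathcomp.real_closed Require Import mxtens.
From mathcomp Require Import ring.
Import GRing.Theory.
Local Open Scope ring_scope.
Local Open Scope classical_set_scope.
Set Implicit Arguments.
Unset Strict Implicit.

(** A derivation [d] satisfies [L_(d u) = d L_u - L_u d] and
    [R_(d u) = d R_u - R_u d], where [L_u] and [R_u] are the left and right
    multiplications by [u]. A commutator has trace zero, so the linear forms
    [u |-> \tr L_u] and [u |-> \tr R_u] vanish on the image of every
    derivation ([Der_tr_left], [Der_tr_right]). These two forms almost decide
    the classification.

    - For [A_1] they are the two coordinate forms, so every derivation is zero.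
    - For [A_2], ..., [A_9] both vanish at [e2] and at least one does not vanish
      at [e1]: the image of a derivation lies in the line of [e2], that is, the
      first row of its matrix is zero ([Der_row0_eq0]). The Leibniz rule on the
      basis then becomes a short system in the second row [z, w]
      ([Der_row1P]). Except for [A_3] and [A_7] the structure matrix is
      [msc a 0 0 c b b2 b3 0], and the system reads [c z = 0], [2 c w = 0] and
      [b w = (b2 + b3 - a) z] ([Der_axisP]); the exceptional parameters of
      [A_4] and [A_8] are those for which [b2 + b3 - a] vanishes.
    - For [A_10], [A_11] and [A_12] both forms are zero, and the Leibniz rule is
      solved directly ([Der_A10_A11P], [Der_A12E]). *)

(** * Matrices of order two and linear consequences *)

Section TwoByTwo.
Variable F : fieldType.
Implicit Type D : 'M[F]_2.

Lemma mx22_eta D : D = mx22 (D 0 0) (D 0 1) (D 1 0) (D 1 1).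
Proof.
by apply/matrixP=> i j; rewrite mxE; case: i j => [[|[|//]] pi] [[|[|//]] pj];
   rewrite /=; congr (D _ _); apply: val_inj.
Qed.

Lemma mx22_0 : mx22 0 0 0 0 = 0 :> 'M[F]_2.
Proof.
by apply/matrixP=> i j; rewrite !mxE; case: i j => [[|[|//]] pi] [[|[|//]] pj].
Qed.

(** Linear elimination in one step: [s = t] follows from one or two equations
    as soon as a polynomial identity, which [ring] can verify, exhibits [s - t]
    as a combination of their defects. *)
Lemma eq_from1 (k l r s t : F) : l = r -> s - t = k * (l - r) -> s = t.
Proof. by move=> -> /eqP; rewrite subrr mulr0 subr_eq0 => /eqP. Qed.

Lemma eq_from2 (k1 k2 l1 r1 l2 r2 s t : F) : l1 = r1 -> l2 = r2 ->
  s - t = k1 * (l1 - r1) + k2 * (l2 - r2) -> s = t.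
Proof. by move=> -> -> /eqP; rewrite !subrr !mulr0 addr0 subr_eq0 => /eqP. Qed.

Lemma mulf_eq0r (k x : F) : k != 0 -> k * x = 0 -> x = 0.
Proof. by move=> k0 /eqP; rewrite mulf_eq0 (negPf k0) => /eqP. Qed.

End TwoByTwo.
Arguments eq_from1 {F} k {l r s t}.
Arguments eq_from2 {F} k1 k2 {l1 r1 l2 r2 s t}.
Arguments mulf_eq0r {F k x}.

(** * The Leibniz rule on the basis and the trace forms *)

Section Leibniz.
Variable F : fieldType.

(** The four pairs are the coordinates of the Leibniz rule at [e1 e1], [e1 e2],
    [e2 e1] and [e2 e2], in this order. *)
Lemma Der_mx22P (a1 a2 a3 a4 b1 b2 b3 b4 x y z w : F) :
  Der (msc a1 a2 a3 a4 b1 b2 b3 b4) (mx22 x y z w) <->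
  [/\ a1 * x + b1 * y = 2%:R * x * a1 + z * (a2 + a3) /\
      a1 * z + b1 * w = 2%:R * x * b1 + z * (b2 + b3),
      a2 * x + b2 * y = (x + w) * a2 + z * a4 + y * a1 /\
      a2 * z + b2 * w = (x + w) * b2 + z * b4 + y * b1,
      a3 * x + b3 * y = (x + w) * a3 + z * a4 + y * a1 /\
      a3 * z + b3 * w = (x + w) * b3 + z * b4 + y * b1 &
      a4 * x + b4 * y = 2%:R * w * a4 + y * (a2 + a3) /\
      a4 * z + b4 * w = 2%:R * w * b4 + y * (b2 + b3)].
Proof.
rewrite /Der /=; set M := (X in X = 0).
(* The sums run over encoded pairs, so that both tensor factors and the entries
   of the structure matrix compute once the sums are expanded. *)
have ME (i k l : 'I_2) : M i (mxtens_index (k, l)) =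
    \sum_(m < 2 * 2) msc a1 a2 a3 a4 b1 b2 b3 b4 i m *
      (mx22 x y z w (mxtens_unindex m).1 k * ((mxtens_unindex m).2 == l)%:R +
       ((mxtens_unindex m).1 == k)%:R * mx22 x y z w (mxtens_unindex m).2 l)
    - \sum_(m < 2) mx22 x y z w i m *
        msc a1 a2 a3 a4 b1 b2 b3 b4 m (mxtens_index (k, l)).
  by rewrite /M !mxE; congr (_ - _); apply: eq_bigr => m _;
     rewrite !mxE mxtens_indexK.
split=> [M0|[[E1 E2] [E3 E4] [E5 E6] [E7 E8]]].
  have {}ME i k l :=
    etrans (esym (ME i k l)) (congr1 (fun X : 'M_(2, _) => X i _) M0).
  split; split; [move: (ME 0 0 0) | move: (ME 1 0 0) | move: (ME 0 0 1)
    | move: (ME 1 0 1) | move: (ME 0 1 0) | move: (ME 1 1 0)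
    | move: (ME 0 1 1) | move: (ME 1 1 1)];
    rewrite !big_ord_recl !big_ord0 !mxE /= => /(eq_from1 (-1)); apply;
    ring.
apply/matrixP=> i j; case: (mxtens_indexP j) => k l; rewrite ME.
case: i k l => [[|[|//]] pi] [[|[|//]] pk] [[|[|//]] pl];
  rewrite !big_ord_recl !big_ord0 !mxE /=;
  [apply: (eq_from1 (-1) E1) | apply: (eq_from1 (-1) E3) | apply: (eq_from1 (-1) E5)
  | apply: (eq_from1 (-1) E7) | apply: (eq_from1 (-1) E2) | apply: (eq_from1 (-1) E4)
  | apply: (eq_from1 (-1) E6) | apply: (eq_from1 (-1) E8)].
all: ring.
Qed.

(** Since [\tr L_u = (a1 + b2) u1 + (a3 + b4) u2], the two equations say that
    [\tr L_(d e1)] and [\tr L_(d e2)] are zero. Each is the sum of two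
    coordinates of the Leibniz rule: the two diagonal entries of
    [L_(d u) - (d L_u - L_u d)] for [u = e1] and for [u = e2]. *)
Lemma Der_tr_left (a1 a2 a3 a4 b1 b2 b3 b4 x y z w : F) :
  Der (msc a1 a2 a3 a4 b1 b2 b3 b4) (mx22 x y z w) ->
  (a1 + b2) * x + (a3 + b4) * z = 0 /\ (a1 + b2) * y + (a3 + b4) * w = 0.
Proof.
move=> /Der_mx22P[[E1 _] [_ E4] [E5 _] [_ E8]]; split.
  by apply: (eq_from2 (-1) (-1) E1 E4); ring.
by apply: (eq_from2 (-1) (-1) E5 E8); ring.
Qed.

Lemma Der_tr_right (a1 a2 a3 a4 b1 b2 b3 b4 x y z w : F) :
  Der (msc a1 a2 a3 a4 b1 b2 b3 b4) (mx22 x y z w) ->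
  (a1 + b3) * x + (a2 + b4) * z = 0 /\ (a1 + b3) * y + (a2 + b4) * w = 0.
Proof.
move=> /Der_mx22P[[E1 _] [E3 _] [_ E6] [_ E8]]; split.
  by apply: (eq_from2 (-1) (-1) E1 E6); ring.
by apply: (eq_from2 (-1) (-1) E3 E8); ring.
Qed.

Lemma Der_row0_eq0 (a1 a2 a3 a4 b1 b2 b3 b4 x y z w : F) :
    a3 + b4 = 0 -> a2 + b4 = 0 -> a1 + b2 != 0 \/ a1 + b3 != 0 ->
  Der (msc a1 a2 a3 a4 b1 b2 b3 b4) (mx22 x y z w) -> x = 0 /\ y = 0.
Proof.
move=> trL2 trR2 tr1 DA.
have [] := Der_tr_left DA; have [] := Der_tr_right DA.
rewrite trL2 trR2 !mul0r !addr0 => Rx Ry Lx Ly.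
by case: tr1 => /mulf_eq0r tr1; split; apply: tr1.
Qed.

Lemma Der_row1P (a1 a2 a3 a4 b1 b2 b3 b4 z w : F) :
  Der (msc a1 a2 a3 a4 b1 b2 b3 b4) (mx22 0 0 z w) <->
  [/\ z * (a2 + a3) = 0 /\ a1 * z + b1 * w = z * (b2 + b3),
      w * a2 + z * a4 = 0 /\ a2 * z = z * b4,
      w * a3 + z * a4 = 0 /\ a3 * z = z * b4 &
      2%:R * w * a4 = 0 /\ a4 * z = w * b4].
Proof.
split=> [/Der_mx22P[[E1 E2] [E3 E4] [E5 E6] [E7 E8]]
        | [[E1 E2] [E3 E4] [E5 E6] [E7 E8]]].
  split; split.
  - by apply: (eq_from1 (-1) E1); ring.
  - by apply: (eq_from1 1 E2); ring.
  - by apply: (eq_from1 (-1) E3); ring.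
  - by apply: (eq_from1 1 E4); ring.
  - by apply: (eq_from1 (-1) E5); ring.
  - by apply: (eq_from1 1 E6); ring.
  - by apply: (eq_from1 (-1) E7); ring.
  - by apply: (eq_from1 1 E8); ring.
apply/Der_mx22P; split; split.
- by apply: (eq_from1 (-1) E1); ring.
- by apply: (eq_from1 1 E2); ring.
- by apply: (eq_from1 (-1) E3); ring.
- by apply: (eq_from1 1 E4); ring.
- by apply: (eq_from1 (-1) E5); ring.
- by apply: (eq_from1 1 E6); ring.
- by apply: (eq_from1 (-1) E7); ring.
- by apply: (eq_from1 1 E8); ring.
Qed.

(** * Sets of derivations *)

Lemma Der_setP (A : 'M[F]_(2, 2 * 2)) (S : set 'M[F]_2) :
  (forall x y z w, Der A (mx22 x y z w) <-> S (mx22 x y z w)) -> Der A = S.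
Proof. by move=> AS; apply/seteqP; split=> D; rewrite [D]mx22_eta; apply AS. Qed.

Lemma Der_eq0 (A : 'M[F]_(2, 2 * 2)) :
    (forall x y z w, Der A (mx22 x y z w) -> [/\ x = 0, y = 0, z = 0 & w = 0]) ->
  Der A = [set 0].
Proof.
move=> A0; apply/seteqP; split=> D /=.
  by rewrite [D]mx22_eta => /A0[-> -> -> ->]; rewrite mx22_0.
by move=> ->; rewrite /Der /= tens0mx tensmx0 addr0 mulmx0 mul0mx subrr.
Qed.

(** * The algebras *)

Lemma Der_A1E (a1 a2 a4 b1 : F) : Der (A_1 a1 a2 a4 b1) = [set 0].
Proof.
apply: Der_eq0 => x y z w DA.
have [L1 L2] := Der_tr_left DA; have [R1 R2] := Der_tr_right DA.
split; [apply: (eq_from1 1 R1) | apply: (eq_from1 1 R2)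
  | apply: (eq_from1 1 L1) | apply: (eq_from1 1 L2)]; ring.
Qed.

(** The algebras [A_2], [A_4], [A_5], [A_6], [A_8] and [A_9] are of this form,
    with [a + b2 = 1] or [a + b3 = 1]. These two sums are the trace forms at
    [e1], which therefore are not both zero, while both vanish at [e2]. *)
Lemma Der_axisP (a c b b2 b3 x y z w : F) : a + b2 = 1 \/ a + b3 = 1 ->
  Der (msc a 0 0 c b b2 b3 0) (mx22 x y z w) <->
  [/\ x = 0, y = 0, c * z = 0, 2%:R * c * w = 0 & b * w = (b2 + b3 - a) * z].
Proof.
move=> tr1; split=> [DA|[-> -> cz cw bw]].
  have [||| x0 y0] := Der_row0_eq0 _ _ _ DA; rewrite ?addr0 //.
    by case: tr1 => ->; [left | right]; apply: oner_neq0.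
  move: DA; rewrite x0 y0 => /Der_row1P[[_ E2] _ _ [E7 E8]]; split=> //.
  - by rewrite E8 mulr0.
  - by apply: (eq_from1 1 E7); ring.
  - by apply: (eq_from1 1 E2); ring.
apply/Der_row1P; split; split; try ring.
- by apply: (eq_from1 1 bw); ring.
- by apply: (eq_from1 1 cz); ring.
- by apply: (eq_from1 1 cz); ring.
- by apply: (eq_from1 1 cw); ring.
- by rewrite cz mulr0.
Qed.

Lemma Der_axis1E (a b b2 b3 : F) : 2%:R != 0 :> F -> a + b2 = 1 \/ a + b3 = 1 ->
  Der (msc a 0 0 1 b b2 b3 0) = [set 0].
Proof.
move=> two0 tr1; apply: Der_eq0 => x y z w /(Der_axisP _ _ _ _ _ _ tr1).
by rewrite mul1r mulr1 => -[-> -> -> /(mulf_eq0r two0)-> _].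
Qed.

Lemma Der_axis_diagE (a b2 b3 : F) : a + b2 = 1 \/ a + b3 = 1 ->
    b2 + b3 - a != 0 ->
  Der (msc a 0 0 0 0 b2 b3 0) = [set D | exists d, D = mx22 0 0 0 d].
Proof.
move=> tr1 k0; apply: Der_setP => x y z w; split=> [/(Der_axisP _ _ _ _ _ _ tr1)|].
  rewrite !mul0r => -[-> -> _ _ /esym /(mulf_eq0r k0)->]; by exists w.
by case=> d ->; apply/Der_axisP => //; rewrite !(mulr0, mul0r).
Qed.

Lemma Der_axis_row1E (a b2 b3 : F) : a + b2 = 1 \/ a + b3 = 1 ->
    b2 + b3 - a = 0 ->
  Der (msc a 0 0 0 0 b2 b3 0) = [set D | exists c d, D = mx22 0 0 c d].
Proof.
move=> tr1 k0; apply: Der_setP => x y z w; split=> [/(Der_axisP _ _ _ _ _ _ tr1)|].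
  by case=> -> -> _ _ _; exists z, w.
by case=> c [d ->]; apply/Der_axisP => //; rewrite k0 !(mulr0, mul0r).
Qed.

Lemma Der_axis_nilE (a b2 b3 : F) : a + b2 = 1 \/ a + b3 = 1 ->
    b2 + b3 - a = 0 ->
  Der (msc a 0 0 0 1 b2 b3 0) = [set D | exists c, D = mx22 0 0 c 0].
Proof.
move=> tr1 k0; apply: Der_setP => x y z w; split=> [/(Der_axisP _ _ _ _ _ _ tr1)|].
  by rewrite k0 mul0r mul1r => -[-> -> _ _ ->]; exists z.
by case=> c ->; apply/Der_axisP => //; rewrite k0 !(mulr0, mul0r).
Qed.

(** The right trace form at [e1] is [b3] and the left one is [b2], so the first
    row is zero; then [d (e1 e1)] and [d (e1 e2)] give [2 z = 0] and [w = 0] in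
    their [e1] coordinates. *)
Lemma Der_A3_A7E (b1 b2 b3 : F) : 2%:R != 0 :> F -> b2 != 0 \/ b3 != 0 ->
  Der (msc 0 1 1 0 b1 b2 b3 (- 1)) = [set 0].
Proof.
move=> two0 tr1; apply: Der_eq0 => x y z w DA.
have [||| x0 y0] := Der_row0_eq0 _ _ _ DA; rewrite ?subrr ?add0r //.
move: DA; rewrite x0 y0 => /Der_row1P[[E1 _] [E3 _] _ _]; split=> //.
  by apply: (mulf_eq0r two0); apply: (eq_from1 1 E1); ring.
by apply: (eq_from1 1 E3); ring.
Qed.

(** The coefficients of [e1] in [d (e1 e2)] and [d (e2 e2)] give [w = 0] and
    [3 y = 0]; then those of [d (e1 e1)] give [2 z = 0] and [2 b1 x = 0]. *)
Lemma Der_A10_A11P (b1 x y z w : F) : 2%:R != 0 :> F -> 3%:R != 0 :> F ->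
  Der (msc 0 1 1 0 b1 0 0 (- 1)) (mx22 x y z w) <->
  [/\ y = 0, z = 0, w = 0 & b1 * x = 0].
Proof.
move=> two0 three0; split=> [/Der_mx22P[[E1 E2] [E3 _] _ [E7 _]]|].
  have y0 : y = 0.
    by apply: (mulf_eq0r three0); apply: (eq_from1 (-1) E7); ring.
  have w0 : w = 0 by apply: (eq_from1 (-1) E3); ring.
  rewrite y0 in E1; rewrite w0 in E2; split=> //; apply: (mulf_eq0r two0).
    by apply: (eq_from1 (-1) E1); ring.
  by apply: (eq_from1 (-1) E2); ring.
case=> -> -> -> b1x; apply/Der_mx22P; split; split; try ring.
by apply: (eq_from1 (- 2%:R) b1x); ring.
Qed.

Lemma Der_A10E : 2%:R != 0 :> F -> 3%:R != 0 :> F ->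
  Der (A_10 F) = [set D | exists a, D = mx22 a 0 0 0].
Proof.
move=> two0 three0; apply: Der_setP => x y z w; split.
  by move/(Der_A10_A11P _ _ _ _ _ two0 three0) => -[-> -> -> _]; exists x.
by case=> a ->; apply/Der_A10_A11P => //; rewrite mul0r.
Qed.

Lemma Der_A11E : 2%:R != 0 :> F -> 3%:R != 0 :> F -> Der (A_11 F) = [set 0].
Proof.
move=> two0 three0; apply: Der_eq0 => x y z w.
move/(Der_A10_A11P _ _ _ _ _ two0 three0).
by rewrite mul1r => -[].
Qed.

(** Here [e1 e1 = e2] is the only nonzero product, so [d e1] is arbitrary and
    determines [d e2 = 2 x e2]. *)
Lemma Der_A12E : Der (A_12 F) = [set D | exists a c, D = mx22 a 0 c (2%:R * a)].
Proof.
apply: Der_setP => x y z w; split=> [/Der_mx22P[[E1 E2] _ _ _]|[a [c ->]]].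
  have y0 : y = 0 by apply: (eq_from1 1 E1); ring.
  have w2 : w = 2%:R * x by apply: (eq_from1 1 E2); ring.
  by exists x, z; rewrite y0 w2.
by apply/Der_mx22P; split; split; ring.
Qed.

End Leibniz.

Lemma natf_neq0_pchar (F : fieldType) p :
  prime p -> p \notin [pchar F] -> p%:R != 0 :> F.
Proof. by move=> pp; rewrite inE pp. Qed.

Unset Implicit Arguments.
Set Strict Implicit.

Theorem theorem4p1 (F : closedFieldType)
    (char2 : 2%N \notin [pchar F]) (char3 : 3%N \notin [pchar F]) :
  (forall a1 a2 a4 b1 : F, Der (A_1 a1 a2 a4 b1) = [set 0]) /\
  (forall a1 b1 b2 : F, Der (A_2 a1 b1 b2) = [set 0]) /\
  (forall b1 b2 : F, Der (A_3 b1 b2) = [set 0]) /\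
  (forall a1 b2 : F, b2 <> 2%:R * a1 - 1 ->
    Der (A_4 a1 b2) = [set D | exists d : F, D = mx22 0 0 0 d]) /\
  (forall a1 : F,
    Der (A_4 a1 (2%:R * a1 - 1)) =
    [set D | exists c d : F, D = mx22 0 0 c d]) /\
  (forall a1 : F, Der (A_5 a1) = [set D | exists c : F, D = mx22 0 0 c 0]) /\
  (forall a1 b1 : F, Der (A_6 a1 b1) = [set 0]) /\
  (forall b1 : F, Der (A_7 b1) = [set 0]) /\
  (forall a1 : F, a1 <> 1 / 3%:R ->
    Der (A_8 a1) = [set D | exists d : F, D = mx22 0 0 0 d]) /\
  Der (A_8 (1 / 3%:R : F)) = [set D | exists c d : F, D = mx22 0 0 c d] /\
  Der (A_9 F) = [set D | exists c : F, D = mx22 0 0 c 0] /\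
  Der (A_10 F) = [set D | exists a : F, D = mx22 a 0 0 0] /\
  Der (A_11 F) = [set 0] /\
  Der (A_12 F) = [set D | exists a c : F, D = mx22 a 0 c (2%:R * a)].
Proof.
have two0 : 2%:R != 0 :> F by apply: natf_neq0_pchar char2.
have three0 : 3%:R != 0 :> F by apply: natf_neq0_pchar char3.
split; first exact: Der_A1E.
split; first by move=> a1 b1 b2; apply: Der_axis1E => //; right; ring.
split; first by move=> b1 b2; apply: Der_A3_A7E => //; right; apply: oner_neq0.
split.
  move=> a1 b2 b2E; apply: Der_axis_diagE; first by right; ring.
  by apply/eqP => k0; apply: b2E; apply: (eq_from1 1 k0); ring.
split; first by move=> a1; apply: Der_axis_row1E; [right |]; ring.
split; first by move=> a1; apply: Der_axis_nilE; [right |]; ring.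
split; first by move=> a1 b1; apply: Der_axis1E => //; left; ring.
split; first by move=> b1; apply: Der_A3_A7E => //; left; apply: oner_neq0.
split.
  move=> a1 a1E; apply: Der_axis_diagE; first by left; ring.
  apply/eqP => k0; apply: a1E; apply: (eq_from1 (- 3%:R^-1) k0); field.
  exact: three0.
split; first by apply: Der_axis_row1E; [left |]; field; apply: three0.
split; first by apply: Der_axis_nilE; [left |]; field; apply: three0.
split; first exact: Der_A10E.
split; first exact: Der_A11E.
exact: Der_A12E.
Qed.
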